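(* Let $\mathcal X\subseteq\mathbb R^d$ be a convex domain, and let $f_1,\dots,f_T:\mathcal X\to\mathbb R$ be any convex loss functions with $\max_{x\in\mathcal X}|f_t(x)|\le1$ for all $t\in\{1,\dots,T\}$. Then the continuous Hedge algorithm with $\eta=\min\{1,\,T^{-1/3}(d\log T)^{1/3}\}$ achieves alternating regret $\mathrm{Reg}_{\mathrm{Alt}}=\mathcal O\!\left(d^{2/3}T^{1/3}\log^{2/3}T\right)$.
   Context: Online convex optimization: in each round $t=1,\dots,T$ the learner picks $x_t\in\mathcal X$, then an adversary picks a convex loss function $f_t:\mathcal X\to\mathbb R$ and reveals it to the learner. Continuous Hedge with parameter $\eta>0$: in each round $t\ge1$, let $p_t$ be the probability density on $\mathcal X$ with $p_t(x)\propto\exp\!\big(-\eta\sum_{\tau=1}^{t-1}f_\tau(x)\big)$; the learner plays $x_t=\int_{\mathcal X}p_t(x)\,x\,dx$ and then observes $f_t$. The point $x_{T+1}$ is defined by the same rule using $f_1,\dots,f_T$. Alternating regret: $\mathrm{Reg}_{\mathrm{Alt}}=\max_{u\in\mathcal X}\left\{\sum_{t=1}^T\big(f_t(x_t)+f_t(x_{t+1})\big)-2\sum_{t=1}^T f_t(u)\right\}$. *)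

(* Defs.v *)
From HB Require Import structures.
From mathcomp Require Import all_boot all_order all_algebra.
From mathcomp Require Import all_classical all_reals all_analysis.

Set Implicit Arguments.
Unset Strict Implicit.
Unset Printing Implicit Defensive.

Import Order.TTheory GRing.Theory Num.Theory.
Import numFieldNormedType.Exports.

Local Open Scope classical_set_scope.
Local Open Scope ring_scope.

Definition rV_display : measure_display.
Proof. exact: default_measure_display. Qed.

Section rV_measurable.
Context {R : realType} (n : nat).

Let coord (i : 'I_n) (v : 'rV[R]_n) : measurableTypeR R := v ord0 i.

Let rV_set0 : g_sigma_preimage coord set0.
Proof. exact: sigma_algebra0. Qed.

Let rV_setC A : g_sigma_preimage coord A -> g_sigma_preimage coord (~` A).
Proof. exact: sigma_algebraC. Qed.

Let rV_bigcup (F : _^nat) : (forall i, g_sigma_preimage coord (F i)) ->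
  g_sigma_preimage coord (\bigcup_i (F i)).
Proof. exact: sigma_algebra_bigcup. Qed.

(* Generated by the coordinates: these are the Borel sets of R^n. *)
HB.instance Definition _ := @isMeasurable.Build rV_display
  'rV[R]_n (g_sigma_preimage coord) rV_set0 rV_setC rV_bigcup.

Lemma measurable_coord (i : 'I_n) :
  measurable_fun [set: 'rV[R]_n] (fun v => v ord0 i : measurableTypeR R).
Proof.
move=> _ Y mY; rewrite setTI; apply: sub_sigma_algebra => /=.
rewrite -bigcup_seq/=; exists i => /=; first by rewrite mem_index_enum.
by exists Y => //; rewrite setTI.
Qed.

Lemma measurable_fun_rVP d (T : measurableType d) (f : T -> 'rV[R]_n) :
  (forall i, measurable_fun setT (fun t => f t ord0 i : measurableTypeR R)) ->
  measurable_fun setT f.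
Proof.
move=> mf _ A mA; rewrite setTI.
have : preimage_set_system setT f (g_sigma_preimage coord) `<=` measurable.
  rewrite -g_sigma_preimageE.
  apply: smallest_sub; first exact: sigma_algebra_measurable.
  move=> _ [B + <-]; rewrite -bigcup_seq/= => -[i _ [C mC <-]].
  by rewrite !setTI -[X in measurable X]setTI; exact: mf.
by apply; exists A => //; rewrite setTI.
Qed.

End rV_measurable.

Section sigma_finite_pack.
Context {R : realType} d (T : measurableType d) (m : {measure set T -> \bar R}).
Hypothesis mT : sigma_finite setT m.

Let m' : set T -> \bar R := m.

HB.instance Definition _ := Measure.on m'.
HB.instance Definition _ := Measure_isSigmaFinite.Build d T R m' mT.

Lemma sigma_finite_pack :
  exists p : {sigma_finite_measure set T -> \bar R}, p = m :> (set T -> _).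
Proof. by exists m'. Qed.

End sigma_finite_pack.

Section rV_lebesgue.
Context {R : realType}.

Definition rV_cons n (p : measurableTypeR R * 'rV[R]_n) : 'rV[R]_n.+1 :=
  row_mx (\row_(j < 1) p.1) p.2.

(* Lebesgue measure on R^n: R^n.+1 is R * R^n with the product measure, and
   R^0 is a point of mass 1. *)
Fixpoint lebesgue_rV n : set 'rV[R]_n -> \bar R :=
  match n with
  | 0 => dirac (0 : 'rV[R]_0)
  | n'.+1 => pushforward (product_measure1 lebesgue_measure (@lebesgue_rV n'))
               (@rV_cons n')
  end.

Lemma rV_cons0 n (p : measurableTypeR R * 'rV[R]_n) : rV_cons p ord0 ord0 = p.1.
Proof.
by rewrite /rV_cons mxE; case: splitP => j //= _; rewrite mxE.
Qed.

Lemma rV_consS n (p : measurableTypeR R * 'rV[R]_n) (i : 'I_n) :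
  rV_cons p ord0 (lift ord0 i) = p.2 ord0 i.
Proof.
rewrite /rV_cons mxE; case: splitP => j /=; first by rewrite ord1.
by rewrite /bump/= !add1n => -[ij]; congr (p.2 _ _); exact/val_inj.
Qed.

Lemma measurable_rV_cons n : measurable_fun setT (@rV_cons n).
Proof.
apply: measurable_fun_rVP => i; case: (unliftP ord0 i) => [j|] ->.
  under eq_fun do rewrite rV_consS.
  exact: (measurableT_comp (measurable_coord j) measurable_snd).
under eq_fun do rewrite rV_cons0.
exact: measurable_fst.
Qed.

Let uncons n (v : 'rV[R]_n.+1) : measurableTypeR R * 'rV[R]_n :=
  (v ord0 ord0, \row_i v ord0 (lift ord0 i)).

Let rV_consK n : cancel (@rV_cons n) (@uncons n).
Proof.
move=> [x v]; rewrite /uncons rV_cons0; congr pair.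
by apply/rowP => i; rewrite mxE rV_consS.
Qed.

Let measurable_uncons n : measurable_fun setT (@uncons n).
Proof.
apply: measurable_fun_pair; first exact: measurable_coord.
apply: measurable_fun_rVP => i.
by under eq_fun do rewrite mxE; exact: measurable_coord.
Qed.

Let lebesgue_rVS_sigma_finite n
    (m : {sigma_finite_measure set 'rV[R]_n -> \bar R}) :
  sigma_finite setT
    (pushforward (product_measure1 (@lebesgue_measure R) m) (@rV_cons n)).
Proof.
have /sigma_finiteP[F [TF ndF Foo]] := sigma_finiteT (@lebesgue_measure R).
have /sigma_finiteP[G [TG ndG Goo]] := sigma_finiteT m.
exists (fun k => @uncons n @^-1` (F k `*` G k)).
  rewrite -preimage_bigcup (_ : \bigcup_k _ = setT) ?preimage_setT//.
  rewrite -setXTT TF TG predeqE => -[x y]; split.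
    by move=> [k _ []/= ? ?]; split; exists k.
  move=> [/= [k _ Fkx] [l _ Gly]]; exists (maxn k l) => //; split.
  - by move: x Fkx; exact/subsetPset/ndF/leq_maxl.
  - by move: y Gly; exact/subsetPset/ndG/leq_maxr.
move=> k; have [? ?] := Foo k; have [? ?] := Goo k; split.
  rewrite -[X in measurable X]setTI; apply: measurable_uncons => //.
  exact: measurableX.
rewrite /pushforward (_ : _ @^-1` _ = F k `*` G k).
  by rewrite product_measure1E// lte_mul_pinfty// ge0_fin_numE.
rewrite -comp_preimage (_ : _ \o _ = id) ?preimage_id//.
by apply/funext => p; exact: rV_consK.
Qed.

Let lebesgue_rV_ex n :
  exists m : {sigma_finite_measure set 'rV[R]_n -> \bar R},
    m = @lebesgue_rV n :> (set _ -> _).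
Proof.
elim: n => [|n [m mE]]; first by exists (dirac (0 : 'rV[R]_0)).
pose q : {measure set (measurableTypeR R * 'rV[R]_n)%type -> \bar R} :=
  product_measure1 (@lebesgue_measure R) m.
pose p : {measure set 'rV[R]_n.+1 -> \bar R} :=
  measure_function_pushforward__canonical__measure_function_Measure q
    (@measurable_rV_cons n).
have [p' p'E] := @sigma_finite_pack _ _ _ p (lebesgue_rVS_sigma_finite m).
by exists p'; rewrite p'E /= -mE.
Qed.

Let lebesgue_rV0 n : lebesgue_rV (set0 : set 'rV[R]_n) = 0%E.
Proof. by have [m <-] := lebesgue_rV_ex n; exact: measure0. Qed.

Let lebesgue_rV_ge0 n (A : set 'rV[R]_n) : (0 <= lebesgue_rV A)%E.
Proof. by have [m <-] := lebesgue_rV_ex n; exact: measure_ge0. Qed.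

Let lebesgue_rV_sigma_additive n :
  semi_sigma_additive (@lebesgue_rV n).
Proof.
by have [m <-] := lebesgue_rV_ex n; exact: measure_semi_sigma_additive.
Qed.

HB.instance Definition _ n := isMeasure.Build _ _ _
  (@lebesgue_rV n)
  (@lebesgue_rV0 n) (@lebesgue_rV_ge0 n) (@lebesgue_rV_sigma_additive n).

Let lebesgue_rV_sigma_finite n :
  sigma_finite setT (@lebesgue_rV n).
Proof. by have [m <-] := lebesgue_rV_ex n; exact: sigma_finiteT. Qed.

HB.instance Definition _ n := Measure_isSigmaFinite.Build _ _ _
  (@lebesgue_rV n) (@lebesgue_rV_sigma_finite n).

Lemma lebesgue_rV_box n (A : 'I_n -> set (measurableTypeR R)) :
  (forall i, measurable (A i)) ->
  lebesgue_rV [set v : 'rV[R]_n | forall i, A i (v ord0 i)] =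
  (\prod_(i < n) lebesgue_measure (A i))%E.
Proof.
elim: n A => [|n IHn] A mA.
  by rewrite big_ord0 /= diracE mem_set// => -[].
pose B := [set v : 'rV[R]_n | forall i, A (lift ord0 i) (v ord0 i)].
have mB : measurable B.
  rewrite (_ : B = \bigcap_(i in [set: 'I_n])
      ((fun v : 'rV[R]_n => v ord0 i : measurableTypeR R)
         @^-1` A (lift ord0 i))).
    apply: fin_bigcap_measurable => // i _.
    by rewrite -[X in measurable X]setTI; exact: measurable_coord.
  by apply/seteqP; split => [v Bv i _|v Bv i]; [exact: Bv|exact: (Bv i)].
rewrite big_ord_recl -IHn// -/B -product_measure1E//.
rewrite [LHS]/= /pushforward; congr (product_measure1 _ _ _).
apply/seteqP; split => [p Ap|p [A0 Bp] i] /=.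
  split => [|i]; first by have := Ap ord0; rewrite rV_cons0.
  by have := Ap (lift ord0 i); rewrite rV_consS.
case: (unliftP ord0 i) => [j|] ->; first by rewrite rV_consS; exact: Bp.
by rewrite rV_cons0.
Qed.

End rV_lebesgue.
Arguments lebesgue_rV {R} n _.

(* Only the values of [f] on [X] matter. Neither [X] nor [f t] has to be Borel:
   for [f t] convex on a convex set [X] with nonempty interior, measurability
   can fail only on the boundary of [X], which is Lebesgue-null. Since the
   integral of a nonnegative function is the supremum of the integrals of the
   Borel simple functions below it, the integrals below agree with those with
   respect to the completed measure. *)
Section hedge.
Context {R : realType} {d : nat}.
Variables (X : set 'rV[R]_d) (f : nat -> 'rV[R]_d -> R) (eta : R).

Definition hedge_weight (t : nat) (x : 'rV[R]_d) : R :=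
  expR (- eta * \sum_(1 <= tau < t) f tau x).

Definition hedge_density (t : nat) (x : 'rV[R]_d) : R :=
  hedge_weight t x / \int[lebesgue_rV d]_(y in X) hedge_weight t y.

Definition hedge_point (t : nat) : 'rV[R]_d :=
  \row_i \int[lebesgue_rV d]_(x in X) (hedge_density t x * x ord0 i).

End hedge.

(* [x] is the sequence of points played by the learner, including x_{T+1}. The
   maximum over [u in X] is a supremum: it need not be attained, as X need not
   be closed and convex functions may jump at the boundary. *)
Definition alternating_regret {R : realType} {d : nat} (X : set 'rV[R]_d)
    (f : nat -> 'rV[R]_d -> R) (T : nat) (x : nat -> 'rV[R]_d) : R :=
  sup [set \sum_(1 <= t < T.+1) (f t (x t) + f t (x t.+1))
           - 2 * \sum_(1 <= t < T.+1) f t u | u in X].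

Definition hedge_eta {R : realType} (d T : nat) : R :=
  Num.min 1 (T%:R `^ (- 3^-1) * (d%:R * ln T%:R) `^ 3^-1).

(* Main.v *)
(* Let p_t be the Hedge density and Z_t its normalising constant. By Jensen, the
   alternating loss f_t(x_t) + f_t(x_{t+1}) is at most E_{p_t} f_t +
   E_{p_{t+1}} f_t. The function s |-> ln E_{p_t} exp(- s f_t) vanishes at 0
   and equals ln (Z_{t+1} / Z_t) at eta; its derivatives at 0 and eta are minus
   those two means, so the trapezoidal rule bounds eta / 2 times the alternating
   loss by ln Z_t - ln Z_{t+1} + O(eta^3), which telescopes. The copy of X
   shrunk by 1 / T towards u has volume vol(X) / T^d and losses within 2 / T of
   those of u, whence ln Z_1 - ln Z_{T+1} <= d ln T + eta (sum_t f_t(u) + 2).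
   The regret is thus O(d ln T / eta + 1 + T eta^2); when d ln T > T the bound
   4T suffices.

   X differs from its interior by a null set, because it lies in all the copies
   of its interior dilated by factors tending to 1. *)
Require Import Defs.
From mathcomp Require Import all_boot all_order all_algebra.
From mathcomp Require Import all_classical all_reals all_analysis.
From mathcomp Require Import measurable_realfun ring lra.

Set Implicit Arguments.
Unset Strict Implicit.
Unset Printing Implicit Defensive.

Import Order.TTheory GRing.Theory Num.Theory.
Import numFieldNormedType.Exports.
Local Open Scope classical_set_scope.
Local Open Scope ring_scope.

(** * Convex sets and functions *)

Section convexity.
Context {R : realType} {V : lmodType R}.
Implicit Types (A : set V) (h : V -> R).

Lemma convex_setP A : @convex_set R V A <->
  forall x y a, 0 <= a <= 1 -> A x -> A y -> A (a *: x + (1 - a) *: y).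
Proof.
split=> [cA x y a /andP[a0 a1] Ax Ay|cA x y l].
  by have := cA x y (Itv01 a0 a1); rewrite !inE; apply.
by rewrite !inE; apply: cA; rewrite ge0/= le1.
Qed.

Lemma convex_functionP A h : @convex_function R V A h <->
  forall x y a, 0 <= a <= 1 -> A x -> A y ->
    h (a *: x + (1 - a) *: y) <= a * h x + (1 - a) * h y.
Proof.
split=> [ch x y a /andP[a0 a1] Ax Ay|ch l x y].
  by have := ch (Itv01 a0 a1) x y; rewrite !inE; apply.
by rewrite !inE; apply: ch; rewrite ge0/= le1.
Qed.

End convexity.

(** * Subgradients and separating functionals *)

Section subgradient.
Context {R : realType} {d : nat}.
Implicit Types (U : set 'rV[R]_d) (h : 'rV[R]_d -> R) (g : 'cV[R]_d).

Local Notation dot v g := ((v *m g) 0 0).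

Let dotD (v w : 'rV[R]_d) g : dot (v + w) g = dot v g + dot w g.
Proof. by rewrite mulmxDl mxE. Qed.

Let dotZ a (v : 'rV[R]_d) g : dot (a *: v) g = a * dot v g.
Proof. by rewrite -scalemxAl mxE. Qed.

(* Hahn-Banach, one coordinate at a time. *)
Lemma subgradient_exists U h z : @convex_set R 'rV[R]_d U ->
  @convex_function R 'rV[R]_d U h -> U z ->
  (forall v, exists2 t, 0 < t & U (z + t *: v)) ->
  exists g, forall y, U y -> h z + dot (y - z) g <= h y.
Proof.
move=> /convex_setP cU /convex_functionP ch Uz intz.
(* Induction on [k]: the functional is built on the span of the first [k] basis vectors and then
   extended to one more. *)
suff claim k : (k <= d)%N -> exists g, forall v : 'rV[R]_d,
    (forall i : 'I_d, (k <= i)%N -> v 0 i = 0) -> U (z + v) ->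
    h z + dot v g <= h (z + v).
  have [g gP] := claim d (leqnn d); exists g => y Uy.
  have := gP (y - z); rewrite (addrC z) subrK; apply => // i.
  by rewrite leqNgt ltn_ord.
elim: k => [_|k IHk kd].
  exists 0 => v v0 _; have -> : v = 0 by apply/rowP => i; rewrite mxE v0.
  by rewrite mul0mx mxE !addr0.
have [g gP] := IHk (ltnW kd); pose i0 := Ordinal kd.
pose e : 'rV[R]_d := delta_mx 0 i0.
pose Vk (v : 'rV[R]_d) := forall i : 'I_d, (k <= i)%N -> v 0 i = 0.
(* Extending along [e] asks for a single number, which must be above all slopes in [lower], taken on
   the side of [- e], and below all slopes on the side of [e]. *)
pose lower := [set r | exists s v, [/\ 0 < s, Vk v, U (z + (v - s *: e)) &
  r = (dot v g + h z - h (z + (v - s *: e))) / s]].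
have lower_upper r t v : lower r -> 0 < t -> Vk v -> U (z + (v + t *: e)) ->
    r <= (h (z + (v + t *: e)) - h z - dot v g) / t.
  move=> [s [v' [s0 v'k Uv' ->]]] t0 vk Uv.
  have st0 : 0 < s + t by rewrite addr_gt0.
  (* The weight at which the [e]-components of the two points cancel, so that [gP] applies to their
     combination. *)
  pose a := s / (s + t).
  have a01 : 0 <= a <= 1.
    by apply/andP; split; rewrite ?divr_ge0 ?ler_pdivrMr ?mul1r ?lerDl// ltW.
  have aE : a *: (z + (v + t *: e)) + (1 - a) *: (z + (v' - s *: e)) =
            z + (a *: v + (1 - a) *: v').
    apply/rowP => j; rewrite !mxE /a.
    by field; rewrite gt_eqF.
  have := cU _ _ _ a01 Uv Uv'; have := ch _ _ _ a01 Uv Uv'.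
  rewrite aE => h1 U1.
  have avk : Vk (a *: v + (1 - a) *: v').
    by move=> j kj; rewrite !mxE vk// v'k// !mulr0 addr0.
  have := le_trans (gP _ avk U1) h1; rewrite dotD !dotZ => h2.
  rewrite ler_pdivrMr// mulrAC ler_pdivlMr//.
  move: h2; rewrite -subr_ge0 -(pmulr_rge0 _ st0) => h2; rewrite -subr_ge0.
  apply: le_trans h2 _; rewrite le_eqVlt; apply/orP; left; apply/eqP.
  rewrite /a; field; exact: lt0r_neq0.
have [tp tp0 Utp] := intz e; have [tm tm0 Utm] := intz (- e).
have Vk0 : Vk 0 by move=> j _; rewrite mxE.
have lower_sup : has_sup lower.
  split.
    exists ((dot (0 : 'rV[R]_d) g + h z - h (z + (0 - tm *: e))) / tm).
    by exists tm, 0; split; rewrite // sub0r -scalerN.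
  by eexists => r /lower_upper; apply; [exact: tp0|exact: Vk0|rewrite add0r].
pose c := sup lower.
(* The entry of [g] at [i0] is replaced by [c]. *)
exists (g + (c - g i0 0) *: delta_mx i0 0) => v vk Uv.
pose w := v - v 0 i0 *: e.
have vE : v = w + v 0 i0 *: e by rewrite subrK.
have wk : Vk w.
  move=> j; rewrite leq_eqVlt => /predU1P[kj|kj]; rewrite !mxE.
    by rewrite (_ : j = i0) ?eqxx ?mulr1 ?subrr//; exact: val_inj.
  rewrite (vk j kj) (_ : (j == i0) = false) ?andbF ?mulr0 ?subr0//.
  by apply/eqP => ji0; rewrite ji0 ltnn in kj.
have dotv : dot v (g + (c - g i0 0) *: delta_mx i0 0) = dot w g + c * v 0 i0.
  rewrite mulmxDr mxE -scalemxAr [X in _ + X]mxE -colE [X in _ * X]mxE.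
  by rewrite {1}vE dotD dotZ -rowE [row _ _ _ _]mxE; ring.
rewrite dotv; have [v0|v0|v0] := ltgtP (v 0 i0) 0.
- have : lower ((dot w g + h z - h (z + v)) / - v 0 i0).
    exists (- v 0 i0), w; split; rewrite ?oppr_gt0//.
      by rewrite scaleNr opprK -vE.
    by rewrite scaleNr opprK -vE.
  move=> /(ub_le_sup lower_sup.2); rewrite -/c ler_pdivrMr ?oppr_gt0//; lra.
- have : c <= (h (z + v) - h z - dot w g) / v 0 i0.
    apply: ge_sup; first exact: lower_sup.1.
    by move=> r lr; rewrite {1}vE; apply: lower_upper => //; rewrite -vE.
  rewrite ler_pdivlMr//; lra.
- have wv : w = v by rewrite /w v0 scale0r subr0.
  by rewrite v0 mulr0 addr0; have := gP w wk; rewrite wv; apply.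
Qed.

End subgradient.

Section separation.
Context {R : realType} {d : nat}.
Implicit Types (U : set 'rV[R]_d) (g : 'cV[R]_d).

(* [g] is a subgradient at [z] of the Minkowski gauge of [U] centred at [x0],
   which is at least 1 at [z], at most 1 on [U] and at most 1/2 on the half-size
   copy of [U]. *)
Lemma convex_separation U x0 z : @convex_set R 'rV[R]_d U -> U x0 ->
  (forall v, exists2 t, 0 < t & U (x0 + t *: v)) -> ~ U z ->
  exists g, forall u, U u -> ((u - z) *m g) 0 0 <= 0 /\
    ((x0 + 2^-1 *: (u - x0) - z) *m g) 0 0 <= - 2^-1.
Proof.
move=> /convex_setP cU Ux0 intx0 Uz.
pose S y := [set t | 0 < t /\ U (x0 + t^-1 *: (y - x0))].
pose p y := inf (S y).
have Sinf y : has_inf (S y).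
  split; last by exists 0 => t [/ltW].
  have [t t0 Ut] := intx0 (y - x0); exists t^-1.
  by split; rewrite ?invr_gt0// invrK.
have p_le y t : S y t -> p y <= t.
  by move=> Syt; apply: ge_inf => //; case: (Sinf y).
have pz : 1 <= p z.
  rewrite leNgt; apply/negP => /(inf_lt (Sinf z).1)[t [t0 Ut] t1]; apply: Uz.
  have t01 : 0 <= t <= 1 by rewrite !ltW.
  have := cU _ _ t t01 Ut Ux0; rewrite (_ : t *: _ + _ = z)//.
  apply/rowP => i; rewrite !mxE; field.
  exact: lt0r_neq0.
have cp : @convex_function R 'rV[R]_d setT p.
  apply/convex_functionP => x y a /andP[a0 a1] _ _; apply/ler_addgt0Pr => e e0.
  have [t [t0 Ut] tx] := inf_adherent e0 (Sinf x).
  have [s [s0 Us] sy] := inf_adherent e0 (Sinf y).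
  have a1' : 0 <= 1 - a by rewrite subr_ge0.
  have T0 : 0 < a * t + (1 - a) * s.
    have [->|a_neq0] := eqVneq a 0; first by rewrite mul0r add0r subr0 mul1r.
    by rewrite ltr_pwDl ?mulr_ge0// ?mulr_gt0// ?lt0r ?a_neq0// ltW.
  (* With [x] and [y] in the copies of [U] scaled by [t] and [s] about [x0], their combination lies
     in the copy scaled by [a * t + (1 - a) * s]; the weight of the first point is the share of
     [a * t] in this sum. *)
  apply: (@le_trans _ _ (a * t + (1 - a) * s)).
    apply: p_le; split => //.
    have b01 : 0 <= a * t / (a * t + (1 - a) * s) <= 1.
      apply/andP; split; first by rewrite divr_ge0 ?mulr_ge0// ltW.
      by rewrite ler_pdivrMr// mul1r lerDl mulr_ge0// ltW.
    have := cU _ _ _ b01 Ut Us.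
    rewrite (_ : _ *: _ + _ = x0 + (a * t + (1 - a) * s)^-1 *:
      (a *: x + (1 - a) *: y - x0))//.
    apply/rowP => i; rewrite !mxE; field.
    by rewrite !lt0r_neq0.
  rewrite -/(p x) -/(p y) in tx sy.
  have := ler_wpM2l a0 (ltW tx); have := ler_wpM2l a1' (ltW sy); lra.
have [|v|g gP] := subgradient_exists _ cp (I : setT z) _.
- by apply/convex_setP.
- by exists 1.
exists g => u Uu; split.
  have := gP u I; have : p u <= 1.
    by apply: p_le; split => //; rewrite invr1 scale1r addrC subrK.
  lra.
have := gP (x0 + 2^-1 *: (u - x0)) I.
have : p (x0 + 2^-1 *: (u - x0)) <= 2^-1.
  apply: p_le; split; first by rewrite invr_gt0.
  by rewrite (_ : _ + _ = u)//; apply/rowP => i; rewrite !mxE; field.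
lra.
Qed.

End separation.

(** * Borel sets and Lebesgue measure of row vectors *)

Section rV_borel.
Context {R : realType} {d : nat}.
Implicit Types (U : set 'rV[R]_d) (f : 'rV[R]_d -> R).

(** Positivity of [r] matters for [d = 0], where the right-hand side is vacuous. *)
Lemma rV_norm_lt (v : 'rV[R]_d) r : 0 < r ->
  (`|v| < r) <-> (forall i, `|v 0 i| < r).
Proof.
move=> r0; rewrite [X in X < _]/Num.norm/= mx_normrE; split.
  by move=> /bigmax_ltP[_ vr] i; exact: (vr (0, i)).
by move=> vr; apply/bigmax_ltP; split => // -[i j] _; rewrite /= ord1.
Qed.

Lemma measurable_rV_box (A : 'I_d -> set (measurableTypeR R)) :
  (forall i, measurable (A i)) ->
  measurable [set v : 'rV[R]_d | forall i, A i (v 0 i)].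
Proof.
move=> mA; rewrite (_ : mkset _ = \bigcap_(i in [set: 'I_d])
    ((fun v : 'rV[R]_d => v 0 i : measurableTypeR R) @^-1` A i)).
  apply: fin_bigcap_measurable => // i _.
  by rewrite -[X in measurable X]setTI; exact: measurable_coord.
by apply/seteqP; split => [v Av i _|v Av i]; [exact: Av|exact: (Av i)].
Qed.

Lemma rV_ballE (v : 'rV[R]_d) r : 0 < r ->
  ball v r = [set w | forall i, ball (v 0 i) r (w 0 i)].
Proof.
move=> r0; apply/seteqP; split=> w.
  rewrite -ball_normE/=.
  by move=> /(rV_norm_lt (v - w) r0) vw i; have := vw i; rewrite !mxE.
move=> vw; rewrite -ball_normE; apply/(rV_norm_lt (v - w) r0) => i.
by rewrite !mxE; exact: vw.
Qed.

Lemma measurable_rV_ball (v : 'rV[R]_d) r : measurable (ball v r).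
Proof.
have [r0|r0] := ltP 0 r; last first.
  rewrite (_ : ball v r = set0)//; apply/seteqP; split => // w.
  rewrite -ball_normE/= => /le_lt_trans-/(_ _ (normr_ge0 _)).
  by rewrite ltNge r0.
rewrite rV_ballE//; apply: (@measurable_rV_box (fun i => ball (v 0 i) r)) => i.
apply: open_measurable; exact: ball_open.
Qed.

(** An open set is the union of the balls with rational centre and radius that it contains; these
    are countably many, and each is a box. *)
Lemma open_measurable_rV U : open U -> measurable U.
Proof.
move=> oU.
pose q2r (q : 'rV[rat]_d) : 'rV[R]_d := map_mx ratr q.
pose B (p : 'rV[rat]_d * rat) := ball (q2r p.1) (ratr p.2 : R).
have -> : U = \bigcup_(p in [set p | B p `<=` U]) B p.
  apply/seteqP; split => [x Ux|x [p /= BU Bx]]; last exact: BU.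
  have /nbhs_ballP[e e0 eU] : nbhs x U by apply: open_nbhs_nbhs.
  (* Half of [e], because a ball of radius [r] whose centre is within [r] of [x] reaches up to
     [2 * r] away from [x]. *)
  have [r /andP[r0 re]] : exists r : rat, 0 < (ratr r : R) < e / 2.
    have [|r] := @rat_in_itvoo R 0 (e / 2); first by rewrite divr_gt0.
    by rewrite in_itv/=; exists r.
  have qP i : exists q : rat, `|x 0 i - ratr q| < (ratr r : R).
    have [|q] := @rat_in_itvoo R (x 0 i - ratr r) (x 0 i + ratr r).
      by rewrite ltrD2l (lt_trans _ r0)// oppr_lt0.
    by rewrite in_itv/= => qx; exists q; rewrite distrC ltr_distl.
  have [q qE] := choice qP.
  have Bx : B (\row_i q i, r) x.
    by rewrite /B rV_ballE//= => i; rewrite !mxE /ball/= distrC; exact: qE.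
  exists (\row_i q i, r) => //= y By; apply: eU.
  rewrite (splitr e); apply: ball_triangle; last first.
    apply: le_ball By; exact: ltW.
  by apply: ball_sym; apply: le_ball Bx; exact: ltW.
rewrite bigcup_mkcond; apply: countable_bigcupT_measurable => // p.
by case: ifP => // _; exact: measurable_rV_ball.
Qed.

Lemma open_continuous_measurable_fun_rV U f : open U ->
  {in U, continuous f} -> measurable_fun U (f : _ -> measurableTypeR R).
Proof.
move=> oU cf; apply: (measurability _ (RGenOInfty.measurableE R)).
move=> /= _ [_ [a ->]] <-; apply: open_measurable_rV.
rewrite openE => x [Ux fx]; apply: filterI; first exact: open_nbhs_nbhs.
apply: cf; first by rewrite inE.
by apply: open_nbhs_nbhs; split => //; exact: rray_open.
Qed.

End rV_borel.

(** * Lebesgue measure under scaling and translation *)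

Section affine_scaling.
Context {R : realType}.

Let pushforward_measure d d' (T : measurableType d) (T' : measurableType d')
    (f : T -> T') (mf : measurable_fun setT f)
    (m : {measure set T -> \bar R}) : {measure set T' -> \bar R} :=
  measure_function_pushforward__canonical__measure_function_Measure m mf.

(** Lebesgue measure is determined by its values on half-open intervals, so the scaled image measure
    is compared with it only there. *)
Lemma lebesgue_measure_affine (a c : R) (A : set (measurableTypeR R)) :
  0 < c -> measurable A ->
  (c%:E * lebesgue_measure ((fun x => (a + c * x)%R) @^-1` A) =
   lebesgue_measure A)%E.
Proof.
move=> c0 mA.
have mf : measurable_fun setT (fun x : measurableTypeR R =>
    a + c * x : measurableTypeR R).
  by apply: measurable_funD => //; apply: measurable_funM.
pose m := mscale (NngNum (ltW c0)) (pushforward_measure mf lebesgue_measure).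
apply/esym; apply: (@lebesgue_measure_unique _ m) => // _ [[x y] _ <-].
rewrite /m/= /mscale/= /pushforward.
rewrite (_ : _ @^-1` _ = `](x - a) / c, (y - a) / c]%classic); last first.
  apply/seteqP; split => z /=; rewrite !in_itv/= ltr_pdivrMr// ler_pdivlMr//;
    rewrite ltrBlDl lerBrDl [z * c]mulrC//.
rewrite !lebesgue_measure_itv/= !lte_fin ltr_pM2r ?invr_gt0// ltrD2r.
case: ifPn => _; last by rewrite mule0.
by rewrite -!EFinB -EFinM; congr EFin; field; exact: lt0r_neq0.
Qed.

Lemma measurable_affine n (a : 'rV[R]_n) (c : R) :
  measurable_fun setT (fun x : 'rV[R]_n => a + c *: x).
Proof.
apply: measurable_fun_rVP => i.
under eq_fun do rewrite !mxE.
apply: measurable_funD => //; apply: measurable_funM => //.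
exact: measurable_coord.
Qed.

(** Through [rV_cons] the map acts separately on the first coordinate and on the rest, and a measure
    with the right values on rectangles is the product measure. *)
Lemma lebesgue_rV_affine n (a : 'rV[R]_n) (c : R) (A : set 'rV[R]_n) :
  0 < c -> measurable A ->
  ((c ^+ n)%:E * lebesgue_rV n ((fun x => (a + c *: x)%R) @^-1` A) =
   lebesgue_rV n A)%E.
Proof.
move=> c0; elim: n => [|n IHn] in a A *.
  move=> mA; rewrite expr0 mul1e; congr (lebesgue_rV _ _).
  by apply/seteqP; split => x /=; rewrite (_ : _ + _ = x)//; apply/rowP => -[].
move=> mA.
pose a' : 'rV[R]_n := \row_i a 0 (lift ord0 i).
pose S (p : measurableTypeR R * 'rV[R]_n) : measurableTypeR R * 'rV[R]_n :=
  (a 0 0 + c * p.1, a' + c *: p.2).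
have mS : measurable_fun setT S.
  apply: measurable_fun_pair.
    by apply: measurable_funD => //; apply: measurable_funM.
  apply: (measurableT_comp (measurable_affine a' c)); exact: measurable_snd.
have cS0 : 0 <= c ^+ n.+1 by rewrite exprn_ge0// ltW.
pose m := mscale (NngNum cS0) (pushforward_measure mS
  (product_measure1 lebesgue_measure (lebesgue_rV n))).
rewrite /= /pushforward (_ : _ @^-1` _ = S @^-1` ((@rV_cons R n) @^-1` A)).
  apply/esym; apply: (@product_measure_unique _ _ _ _ _ _ _ m); last first.
    by rewrite -[X in measurable X]setTI; exact: measurable_rV_cons.
  move=> B C mB mC; rewrite /m/= /mscale/= /pushforward.
  rewrite (_ : S @^-1` _ = ((fun x => a 0 0 + c * x) @^-1` B) `*`
     ((fun x => a' + c *: x) @^-1` C))//.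
  rewrite product_measure1E.
  - rewrite -(lebesgue_measure_affine (a 0 0) c0 mB) -(IHn a' C mC).
    by rewrite exprS EFinM muleACA.
  - rewrite -[X in measurable X]setTI.
    exact: (measurable_funD _ (measurable_funM _ _)).
  - by rewrite -[X in measurable X]setTI; exact: measurable_affine.
rewrite -comp_preimage; congr (_ @^-1` A); apply/funext => p/=; apply/rowP => i.
rewrite [LHS]mxE [X in _ + X]mxE.
by case: (unliftP ord0 i) => [j|] ->; rewrite ?rV_consS ?rV_cons0 //= !mxE.
Qed.

End affine_scaling.

(** * Integrals of functions that agree off a null set *)

Section null_modification.
Context d (T : measurableType d) (R : realType).
Variable mu : {measure set T -> \bar R}.
Local Open Scope ereal_scope.

Import HBNNSimple.

(** The integral of [f] is a supremum over simple functions [h] below [f]. Setting [h] to 0 on [N]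
    keeps its integral and puts it below [g] everywhere. *)
Let ge0_le_integral_null (N : set T) (f g : T -> \bar R) : measurable N ->
  mu N = 0 -> (forall x, 0 <= f x) -> (forall x, 0 <= g x) ->
  (forall x, ~ N x -> f x = g x) -> \int[mu]_x f x <= \int[mu]_x g x.
Proof.
move=> mN N0 f0 g0 fg; rewrite (ge0_integralTE mu f0).
apply: ge_ereal_sup => _ [h /= hf <-].
have mNC : measurable (~` N) by exact: measurableC.
have -> : sintegral mu h = sintegral mu (proj_nnsfun h mNC).
  rewrite -!integralT_nnsfun -[RHS]/(\int[mu]_x ((proj_nnsfun h mNC x)%:E)).
  rewrite (ge0_negligible_integral mN)//.
  - rewrite setTD integral_mkcond; apply: eq_integral => x _.
    by rewrite -mrestrict restrict_EFin.
  - by apply/measurable_EFinP.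
  - by move=> x _; rewrite lee_fin.
rewrite (ge0_integralTE mu g0); apply: ereal_sup_ubound.
exists (proj_nnsfun h mNC) => // x; rewrite -mrestrict patchE.
by case: ifPn => // /set_mem /fg <-.
Qed.

(* Neither function has to be measurable. *)
Lemma eq_integral_null (N : set T) (f g : T -> \bar R) : measurable N ->
  mu N = 0 -> (forall x, ~ N x -> f x = g x) ->
  \int[mu]_x f x = \int[mu]_x g x.
Proof.
move=> mN N0 fg; rewrite [LHS]integralE [RHS]integralE.
congr (_ - _); apply/eqP; rewrite eq_le; apply/andP; split;
  apply: (ge0_le_integral_null mN N0) => //= x Nx;
  by rewrite ?funeposE ?funenegE fg.
Qed.

Lemma eq_Rintegral_null (A B N : set T) (f : T -> R) : measurable N ->
  mu N = 0 -> A `<=` B -> B `<=` A `|` N ->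
  (\int[mu]_(x in A) f x = \int[mu]_(x in B) f x)%R.
Proof.
move=> mN N0 AB BAN; rewrite /Rintegral; congr fine.
rewrite (integral_mkcond A) (integral_mkcond B).
apply: (eq_integral_null mN N0) => x Nx; rewrite !patchE.
rewrite (_ : (x \in A) = (x \in B))//.
apply/idP/idP; rewrite !inE; first exact: AB.
by move=> /BAN[].
Qed.

End null_modification.

(** * Interiors of convex sets *)

Section convex_interior.
Context {R : realType} {V : normedModType R}.
Implicit Types (A : set V) (x y z : V).

(** A ball of radius [e] around [x] inside [A] shrinks towards [y] to a ball of radius [a * e]
    around the combination. *)
Lemma convex_interior_segment A x y a : @convex_set R V A -> A° x -> A y ->
  0 < a <= 1 -> A° (a *: x + (1 - a) *: y).
Proof.
move=> /convex_setP cA /nbhs_ballP[e /= e0 eA] Ay /andP[a0 a1].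
apply/nbhs_ballP; exists (a * e); rewrite /= ?mulr_gt0// => w.
rewrite -ball_normE/= => zw.
have -> : w = a *: (x + a^-1 *: (w - (a *: x + (1 - a) *: y))) + (1 - a) *: y.
  rewrite scalerDr scalerA divff ?gt_eqF// scale1r addrAC.
  by rewrite [RHS]addrC subrK.
apply: cA => //; first by rewrite ltW.
apply: eA; rewrite -ball_normE/= opprD addNKr normrN normrZ.
by rewrite gtr0_norm ?invr_gt0// mulrC ltr_pdivrMr// distrC mulrC.
Qed.

Lemma convex_interior A : @convex_set R V A -> @convex_set R V A°.
Proof.
move=> cA; apply/convex_setP => x y a /andP[a0 a1] Ax Ay.
move: a0; rewrite le_eqVlt => /predU1P[<-|a0].
  by rewrite scale0r add0r subr0 scale1r.
by apply: convex_interior_segment; rewrite ?a0//; exact: interior_subset.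
Qed.

Lemma open_line A x v : open A -> A x -> exists2 t : R, 0 < t & A (x + t *: v).
Proof.
move=> oA Ax; have /nbhs_ballP[e /= e0 eA] := open_nbhs_nbhs (conj oA Ax).
have v0 : 0 < `|v| + 1 by rewrite ltr_wpDl.
exists (e / (`|v| + 1)); first by rewrite divr_gt0.
apply: eA; rewrite -ball_normE/= opprD addNKr normrN normrZ.
rewrite gtr0_norm ?divr_gt0// mulrAC ltr_pdivrMr// ltr_pM2l//.
by rewrite ltrDl.
Qed.

End convex_interior.

Section convex_measure.
Context {R : realType} {d : nat}.
Implicit Types (A U X : set 'rV[R]_d).

Lemma lebesgue_rV_ball (x : 'rV[R]_d) r : 0 < r ->
  lebesgue_rV d (ball x r) = ((r *+ 2) ^+ d)%:E.
Proof.
move=> r0; rewrite rV_ballE//.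
rewrite (lebesgue_rV_box (A := fun i => ball (x 0 i) r)); last first.
  by move=> i; apply: open_measurable; exact: ball_open.
under eq_bigr do rewrite lebesgue_measure_ball ?ltW//.
by rewrite prodEFin prodr_const card_ord.
Qed.

Lemma lebesgue_rV_open_gt0 U : open U -> U !=set0 -> (0 < lebesgue_rV d U)%E.
Proof.
move=> oU [x Ux]; have /nbhs_ballP[e /= e0 eU] := open_nbhs_nbhs (conj oU Ux).
apply: (@lt_le_trans _ _ (lebesgue_rV d (ball x e))).
  by rewrite lebesgue_rV_ball// lte_fin exprn_gt0// pmulrn_lgt0.
by apply: le_measure; rewrite ?inE//; [exact: measurable_rV_ball|
  exact: open_measurable_rV].
Qed.

Lemma lebesgue_rV_bounded_lty A : measurable A -> bounded_set A ->
  (lebesgue_rV d A < +oo)%E.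
Proof.
move=> mA [M [_ AM]]; pose r := `|M| + 2.
have r0 : 0 < r by rewrite ltr_wpDl.
apply: (@le_lt_trans _ _ (lebesgue_rV d (ball 0 r))); last first.
  by rewrite lebesgue_rV_ball// ltry.
apply: le_measure; rewrite ?inE//; first exact: measurable_rV_ball.
move=> y Ay; rewrite -ball_normE/= sub0r normrN.
apply: (@le_lt_trans _ _ (`|M| + 1)); last by rewrite ltrD2l ltrDr.
by apply: AM Ay; rewrite ltr_pwDr// ler_norm.
Qed.

(** The intersection [W] of dilated copies of the interior is measurable, contains [X] and has no
    more volume than the interior; [N] is [W] without the interior. Boundedness makes the volumes
    finite, so that they can be subtracted. *)
Lemma convex_diff_interior_null X : @convex_set R 'rV[R]_d X ->
  bounded_set X -> X° !=set0 ->
  exists N, [/\ measurable N, lebesgue_rV d N = 0%E & X `<=` X° `|` N].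
Proof.
move=> cX bX [x0 X0]; have oU : open X° by exact: open_interior.
have mU := open_measurable_rV oU.
pose c n : R := 1 - (n.+2%:R)^-1.
have c01 n : 0 < c n < 1.
  by rewrite subr_gt0 invf_lt1// ltr1n/= ltrBlDr ltrDl invr_gt0.
(* The interior dilated about [x0] by the factor [(c n)^-1]. *)
pose V n := (fun y : 'rV[R]_d => (1 - c n) *: x0 + c n *: y) @^-1` X°.
have XV n : X `<=` V n.
  have /andP[c0 c1] := c01 n.
  move=> y Xy; rewrite /V/= -{2}(subKr 1 (c n)).
  apply: convex_interior_segment => //.
  by rewrite subr_gt0 c1 lerBlDr lerDl ltW.
have mV n : measurable (V n).
  by rewrite -[X in measurable X]setTI; exact: measurable_affine.
pose W := \bigcap_n V n.
have mW : measurable W by apply: bigcap_measurable => //; exists 0%N.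
have XW : X `<=` W by move=> x Xx n _; exact: XV.
have UW : X° `<=` W by apply: subset_trans XW; exact: interior_subset.
have Ufin : (lebesgue_rV d X° < +oo)%E.
  apply: lebesgue_rV_bounded_lty => //.
  have [M [Mr MX]] := bX; exists M; split => // r Mlt y /interior_subset.
  exact: MX.
have cW n : ((c n ^+ d)%:E * lebesgue_rV d W <= lebesgue_rV d X°)%E.
  have /andP[c0 _] := c01 n.
  rewrite -(lebesgue_rV_affine ((1 - c n) *: x0) c0 mU).
  apply: lee_wpmul2l; first by rewrite lee_fin exprn_ge0// ltW.
  apply: le_measure; rewrite ?inE//; first exact: (mV n).
  by move=> x; exact.
exists (W `\` X°); split.
- exact: measurableD.
- have WU : (lebesgue_rV d W <= lebesgue_rV d X°)%E.
    have c0d : 0 < c 0%N ^+ d by rewrite exprn_gt0//; have /andP[] := c01 0%N.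
    move: cW Ufin; have : (0 <= lebesgue_rV d W)%E by [].
    have : (0 <= lebesgue_rV d X°)%E by [].
    case: (lebesgue_rV d X°) => // u u0.
    case: (lebesgue_rV d W) => // [m m0|_].
      move=> cW _; rewrite lee_fin.
      have cvgc : c n ^+ d * m @[n --> \oo] --> m.
        rewrite -[X in _ --> X]mul1r -(expr1n _ d) -(subr0 1).
        apply: cvgMl; apply: (@cvg_comp _ _ _ c (fun x => x ^+ d)); last first.
          exact: exprn_continuous.
        apply: cvgB; first exact: cvg_cst.
        have := @cvg_harmonic R; rewrite -cvg_shiftS; exact.
      rewrite -(cvg_lim _ cvgc)//.
      apply: limr_le; first by apply/cvg_ex; exists m.
      by apply: nearW => n; have := cW n; rewrite -EFinM lee_fin.
    (* If [W] had infinite volume, [cW] at index 0 would make the volume of the interior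
       infinite. *)
    by move=> /(_ 0%N); rewrite gt0_muley ?lte_fin.
  have Wfin : (lebesgue_rV d W < +oo)%E by exact: le_lt_trans Ufin.
  apply/eqP; rewrite eq_le measure_ge0 andbT measureD// (setIidr UW).
  by rewrite leeBlDr ?add0e// ge0_fin_numE.
- move=> x Xx; have [|nUx] := pselect (X° x); first by left.
  by right; split => //; exact: XW.
Qed.

End convex_measure.

(** * The trapezoidal rule *)

Section exponential_inequalities.
Context {R : realType}.
Implicit Types w u : R.

Lemma expR_sub1_le w : expR w - 1 <= w * expR w.
Proof.
have := expR_ge1Dx (- w); rewrite expRN => /(ler_wpM2l (expR_ge0 w)).
by rewrite mulfV ?gt_eqF ?expR_gt0//; lra.
Qed.

(** The middle term is twice the error of the trapezoidal rule for [expR] on [0, u]. It vanishes at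
    0 and its derivative at [c] lies between 0 and [c ^+ 2 * expR c], so the mean value theorem
    applies. *)
Lemma expR_trapezoid_bounds u : 0 <= u ->
  0 <= expR u * (u - 2) + u + 2 <= u ^+ 3 * expR u.
Proof.
rewrite le_eqVlt => /predU1P[<-|u0].
  by rewrite expR0 expr0n/= mul0r; apply/andP; split; lra.
pose k x : R := expR x * (x - 2) + x + 2.
pose k' x : R := expR x * (x - 1) + 1.
have dk (x : R) : is_derive x (1 : R) k (k' x).
  rewrite /k /k'; apply: is_derive_eq; rewrite /GRing.scale/=; ring.
have kc : {within `[0, u], continuous k}.
  apply: continuous_subspaceT => x; apply: differentiable_continuous.
  by apply/derivable1_diffP; exact: ex_derive.
have [c] := MVT u0 (fun x _ => dk x) kc.
rewrite in_itv/= => /andP[c0 cu] kE.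
have k'_ge0 : 0 <= k' c.
  have := expR_sub1_le c; rewrite /k'; lra.
have k'_le : k' c <= c ^+ 2 * expR c.
  have := expR_ge1Dx c; have := expR_gt0 c; rewrite /k' => e0 e1.
  (* The claim amounts to [1 <= expR c * (1 - c + c ^+ 2)], and the left-hand side here is
     [1 + c ^+ 3]. *)
  have : (1 + c) * (1 - c + c ^+ 2) <= expR c * (1 - c + c ^+ 2).
    rewrite ler_wpM2r//; nra.
  nra.
have -> : expR u * (u - 2) + u + 2 = k' c * u.
  by rewrite -[u in RHS]subr0 -kE /k expR0; ring.
rewrite mulr_ge0 ?(ltW u0)//= exprSr mulrAC ler_wpM2r ?(ltW u0)//.
apply: (le_trans k'_le); rewrite ler_pM ?exprn_ge0 ?expR_ge0 ?(ltW c0)//.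
  by rewrite lerXn2r ?nnegrE ?ltW// (lt_trans c0).
by rewrite ler_expR ltW.
Qed.

(* The trapezoidal rule on [0, w] approximates [expR w - 1] by
   [w * (1 + expR w) / 2]. *)
Lemma expR_trapezoid w :
  expR w - 1 - w <= 2^-1 * (w * (expR w - 1)) + 2^-1 * `|w| ^+ 3.
Proof.
have [w0|w0] := leP 0 w.
  have /andP[+ _] := expR_trapezoid_bounds w0.
  rewrite ger0_norm//; have : 0 <= w ^+ 3 by rewrite exprn_ge0.
  lra.
(* For negative [w], the upper bound at [- w] is multiplied by [expR w]. *)
have Nw0 : 0 <= - w by rewrite oppr_ge0 ltW.
have /andP[_] := expR_trapezoid_bounds Nw0.
rewrite ltr0_norm// => /(ler_wpM2r (expR_ge0 w)).
rewrite -(mulrA _ _ (expR w)) !mulrDl -(mulrAC _ (expR w)) -expRD addNr expR0.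
lra.
Qed.

(** By [expR_sub1_le] the left-hand side is at most [w * (expR w - 1)]. Then [expR w - 1] is bounded
    by [w * expR w] if [w >= 0], and from below by [w] otherwise. *)
Lemma expR_quadratic w : w <= 2 -> expR w - 1 - w <= expR 2 * w ^+ 2.
Proof.
move=> w2; have e2 : 1 <= expR 2 :> R by rewrite -[leLHS]expR0 ler_expR.
have := expR_sub1_le w; have := expR_ge1Dx w.
have [w0|w0] := leP 0 w.
  have : expR w <= expR 2 by rewrite ler_expR.
  have := expR_gt0 w; move: (expR w) (expR 2) e2 => a b *.
  have : w * (a - 1) <= w * (w * a) by rewrite ler_wpM2l.
  have : w * (w * a) <= w * (w * b) by rewrite !ler_wpM2l.
  nra.
move: (expR w) (expR 2) e2 => a b *; nra.
Qed.

End exponential_inequalities.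

(** * Bounded measurable functions *)

Section bounded_measurable_functions.
Context d (T : measurableType d) (R : realType).
Variables (D : set T).
Implicit Types f g : T -> R.

(** This class is closed under sums, products and exponentials and consists of integrable functions
    when the domain has finite measure, so integrability follows from the shape of the integrand. *)
Definition bounded_mfun f :=
  measurable_fun D f /\ exists M, forall x, D x -> `|f x| <= M.

Lemma bounded_mfun_cst c : bounded_mfun (fun=> c).
Proof. by split; [exact: measurable_cst|exists `|c|]. Qed.

Lemma bounded_mfunD f g : bounded_mfun f -> bounded_mfun g ->
  bounded_mfun (fun x => f x + g x).
Proof.
move=> [mf [M fM]] [mg [N gN]]; split; first exact: measurable_funD.
exists (M + N) => x Dx; apply: (le_trans (ler_normD _ _)).
by rewrite lerD// ?fM ?gN.
Qed.

Lemma bounded_mfunM f g : bounded_mfun f -> bounded_mfun g ->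
  bounded_mfun (fun x => f x * g x).
Proof.
move=> [mf [M fM]] [mg [N gN]]; split; first exact: measurable_funM.
by exists (M * N) => x Dx; rewrite normrM ler_pM// ?fM ?gN.
Qed.

Lemma bounded_mfun_sum (I : eqType) (r : seq I) (F : I -> T -> R) :
  (forall i, i \in r -> bounded_mfun (F i)) ->
  bounded_mfun (fun x => \sum_(i <- r) F i x).
Proof.
elim: r => [_|i r IHr bF].
  by under eq_fun do rewrite big_nil; exact: bounded_mfun_cst.
under eq_fun do rewrite big_cons; apply: bounded_mfunD.
  by apply: bF; rewrite mem_head.
by apply: IHr => j jr; apply: bF; rewrite inE jr orbT.
Qed.

Lemma bounded_mfun_expR f :
  bounded_mfun f -> bounded_mfun (fun x => expR (f x)).
Proof.
move=> [mf [M fM]]; split; first exact: (measurableT_comp (@measurable_expR R)).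
exists (expR M) => x Dx; rewrite ger0_norm ?expR_ge0// ler_expR.
by apply: le_trans (fM x Dx); exact: ler_norm.
Qed.

Variable mu : {measure set T -> \bar R}.
Hypotheses (mD : measurable D) (Doo : (mu D < +oo)%E).

Lemma bounded_mfun_integrable f :
  bounded_mfun f -> mu.-integrable D (EFin \o f).
Proof.
move=> [mf [M fM]]; apply: measurable_bounded_integrable => //.
exists M; split; first exact: num_real.
by move=> N MN x Dx /=; apply: (le_trans (fM x Dx)); exact: ltW.
Qed.

Local Notation Int := (Rintegral mu D).

Lemma Rintegral_bmfunD f g : bounded_mfun f -> bounded_mfun g ->
  Int (fun x => f x + g x) = Int f + Int g.
Proof.
by move=> bf bg; apply: RintegralD => //; exact: bounded_mfun_integrable.
Qed.

Lemma Rintegral_bmfunZ c f :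
  bounded_mfun f -> Int (fun x => c * f x) = c * Int f.
Proof.
by move=> bf; apply: RintegralZl => //; exact: bounded_mfun_integrable.
Qed.

Lemma Rintegral_bmfun_sum (J : eqType) (r : seq J) (c : J -> R)
    (F : J -> T -> R) :
  (forall i, bounded_mfun (F i)) ->
  Int (fun x => \sum_(i <- r) c i * F i x) = \sum_(i <- r) c i * Int (F i).
Proof.
move=> bF; elim: r => [|i r IHr].
  by rewrite big_nil; under eq_Rintegral do rewrite big_nil;
    rewrite Rintegral_cst// mul0r.
rewrite big_cons -IHr -Rintegral_bmfunZ// -Rintegral_bmfunD.
- by apply: eq_Rintegral => x _; rewrite big_cons.
- by apply: bounded_mfunM => //; exact: bounded_mfun_cst.
- apply: bounded_mfun_sum => j _.
  by apply: bounded_mfunM => //; exact: bounded_mfun_cst.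
Qed.

Lemma le_Rintegral_bmfun f g : bounded_mfun f -> bounded_mfun g ->
  (forall x, D x -> f x <= g x) -> Int f <= Int g.
Proof.
by move=> bf bg; apply: le_Rintegral => //; exact: bounded_mfun_integrable.
Qed.

End bounded_measurable_functions.

Section hedge_step.
Context d (T : measurableType d) (R : realType).
Variables (mu : {measure set T -> \bar R}) (D : set T).
Hypotheses (mD : measurable D) (Doo : (mu D < +oo)%E).
Variables (w f : T -> R) (eta : R).
Hypotheses (bw : bounded_mfun D w) (bf : bounded_mfun D f).
Hypotheses (w_ge0 : forall x, D x -> 0 <= w x).
Hypotheses (f_le1 : forall x, D x -> `|f x| <= 1).
Hypotheses (eta01 : 0 < eta <= 1).

Let w' x := expR (- eta * f x) * w x.

Local Notation Int := (Rintegral mu D).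

Let Z := Int w.
Let Z' := Int w'.
Hypotheses (Z_gt0 : 0 < Z) (Z'_gt0 : 0 < Z').

Let A := Int (fun x => f x * w x) / Z.
Let B := Int (fun x => f x * w' x) / Z'.

(** [A * Z] and [B * Z'] are the integrals of [f * w] and [f * w']. Each integral inequality below
    thus reduces to a pointwise one, linear in the four integrands. *)
Let I_combination_ge0 a b c e :
  (forall x, D x ->
    0 <= a * w' x + b * w x + c * (f x * w x) + e * (f x * w' x)) ->
  0 <= a * Z' + b * Z + c * (A * Z) + e * (B * Z').
Proof.
have bw' : bounded_mfun D w'.
  apply: bounded_mfunM => //; apply: bounded_mfun_expR.
  by apply: bounded_mfunM => //; exact: bounded_mfun_cst.
have bZ k g : bounded_mfun D g -> bounded_mfun D (fun x => k * g x).
  by move=> bg; apply: bounded_mfunM => //; exact: bounded_mfun_cst.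
have bfw : bounded_mfun D (fun x => f x * w x) by exact: bounded_mfunM.
have bfw' : bounded_mfun D (fun x => f x * w' x) by exact: bounded_mfunM.
move=> ge0; rewrite /A /B !divfK ?gt_eqF//.
rewrite -!(Rintegral_bmfunZ mD Doo)// -!(Rintegral_bmfunD mD Doo)//.
- exact: Rintegral_ge0.
- by apply: bounded_mfunD; [apply: bounded_mfunD|]; exact: bZ.
- exact: bZ.
- by apply: bounded_mfunD; exact: bZ.
- exact: bZ.
- exact: bZ.
- exact: bZ.
Qed.

(* [A] and [B] are the means of [f] before and after the weights are multiplied
   by [expR (- eta * f)]; they are minus the derivatives of [s |-> ln (Int (expR
   (- s * f) * w))] at [0] and [eta], so this is the trapezoidal rule. *)
Lemma hedge_trapezoid :
  2^-1 * eta * (A + B) <=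
    ln Z - ln Z' + (4 + 16 * expR 2 ^+ 2) * eta ^+ 3.
Proof.
have /andP[eta0 eta1] := eta01.
have A_ge : -1 <= A.
  have : 0 <= 0 * Z' + 1 * Z + 1 * (A * Z) + 0 * (B * Z').
    apply: I_combination_ge0 => x Dx; have := f_le1 Dx; rewrite ler_norml.
    by move=> /andP[? ?]; have := w_ge0 Dx; nra.
  rewrite !mul0r !mul1r add0r addr0 -[X in X + _]mul1r -mulrDl.
  by rewrite pmulr_lge0//; lra.
have A_le : A <= 1.
  have : 0 <= 0 * Z' + 1 * Z + (-1) * (A * Z) + 0 * (B * Z').
    apply: I_combination_ge0 => x Dx; have := f_le1 Dx; rewrite ler_norml.
    by move=> /andP[? ?]; have := w_ge0 Dx; nra.
  rewrite !mul0r !mul1r add0r addr0 mulN1r -[X in X - _]mul1r -mulrBl.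
  by rewrite pmulr_lge0//; lra.
pose E := expR (eta * A); have E0 : 0 < E by exact: expR_gt0.
(* Centring at the mean: [W] has mean 0 under the weights [w], and the mean of [expR (W x)] is the
   number [M] below. *)
pose W x := eta * (A - f x).
have WE x : expR (W x) * w x = E * w' x.
  by rewrite /E /w' mulrA -expRD /W; congr (expR _ * _); ring.
have W_le x : D x -> `|W x| <= 2 * eta.
  move=> Dx; rewrite normrM gtr0_norm// mulrC ler_wpM2r ?(ltW eta0)//.
  have := f_le1 Dx; rewrite !ler_norml => /andP[? ?]; apply/andP; split; lra.
(* [expR_trapezoid] at [W x], integrated against [w]; half of [(2 * eta) ^+ 3] gives the constant
   4. *)
have E1 : 0 <= (2^-1 * eta * A * E - E) * Z' +
    (4 * eta ^+ 3 + 1 + 2^-1 * eta * A) * Z +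
    (- (2^-1 * eta)) * (A * Z) + (- (2^-1 * eta * E)) * (B * Z').
  apply: I_combination_ge0 => x Dx.
  have W3 : `|W x| ^+ 3 <= 8 * eta ^+ 3.
    rewrite (_ : 8 * _ = (2 * eta) ^+ 3); last ring.
    by rewrite lerXn2r ?nnegrE ?W_le// mulr_ge0 ?ltW.
  have := expR_trapezoid (W x).
  rewrite -subr_ge0 => /(mulr_ge0 (w_ge0 Dx)) ineq.
  have : 0 <= w x * (8 * eta ^+ 3 - `|W x| ^+ 3).
    by rewrite mulr_ge0 ?w_ge0// subr_ge0.
  have := WE x; move: ineq; rewrite /W; set e := expR _; set n := `|_|.
  move=> ineq ew n3.
  have -> : (2^-1 * eta * A * E - E) * w' x +
    (4 * eta ^+ 3 + 1 + 2^-1 * eta * A) * w x +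
    (- (2^-1 * eta)) * (f x * w x) + (- (2^-1 * eta * E)) * (f x * w' x) =
    (2^-1 * eta * A - 1) * (E * w' x) +
    (4 * eta ^+ 3 + 1 + 2^-1 * eta * A) * w x +
    (- (2^-1 * eta)) * (f x * w x) + (- (2^-1 * eta)) * (f x * (E * w' x)).
    ring.
  rewrite -ew; lra.
(* [expR_quadratic] at [W x], integrated: the linear term drops out, whence [M - 1] is of order
   [eta ^+ 2]. *)
have E2 : 0 <= (- E) * Z' + (4 * expR 2 * eta ^+ 2 + 1 + eta * A) * Z +
    (- eta) * (A * Z) + 0 * (B * Z').
  apply: I_combination_ge0 => x Dx.
  have W2 : W x ^+ 2 <= 4 * eta ^+ 2.
    rewrite (_ : 4 * _ = (2 * eta) ^+ 2); last ring.
    rewrite -(real_normK (num_real (W x))) lerXn2r ?nnegrE ?W_le//.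
    by rewrite mulr_ge0 ?ltW.
  have Wx2 : W x <= 2.
    apply: (le_trans (ler_norm _)); apply: (le_trans (W_le _ Dx)); lra.
  have := expR_quadratic Wx2.
  rewrite -subr_ge0 => /(mulr_ge0 (w_ge0 Dx)) ineq.
  have : 0 <= w x * (expR 2 * (4 * eta ^+ 2 - W x ^+ 2)).
    by rewrite mulr_ge0 ?w_ge0// mulr_ge0 ?expR_ge0// subr_ge0.
  have := WE x; move: ineq; set e := expR (W x); set n := W x ^+ 2.
  by rewrite /W mulNr => ineq <-; lra.
have E3 : 0 <= E * Z' + (- (1 + eta * A)) * Z + eta * (A * Z) + 0 * (B * Z').
  apply: I_combination_ge0 => x Dx; have := expR_ge1Dx (W x).
  rewrite -subr_ge0 => /(mulr_ge0 (w_ge0 Dx)) ineq.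
  have := WE x; move: ineq; set e := expR _.
  by rewrite /W => ineq <-; lra.
pose M := E * Z' / Z.
have M0 : 0 < M by rewrite divr_gt0 ?mulr_gt0.
have MZ : M * Z = E * Z' by rewrite /M divfK// gt_eqF.
have M1 : 1 <= M by rewrite /M ler_pdivlMr// mul1r; lra.
have M2 : M - 1 <= 4 * expR 2 * eta ^+ 2.
  by rewrite -(ler_pM2r Z_gt0) mulrBl MZ; lra.
have M3 : M - 1 <= 2^-1 * eta * (A - B) * M + 4 * eta ^+ 3.
  rewrite -(ler_pM2r Z_gt0) mulrBl mulrDl -(mulrA _ M) MZ; lra.
have lnM : ln M = eta * A + ln Z' - ln Z.
  by rewrite /M ln_div ?posrE ?mulr_gt0// lnM ?posrE// /E expRK.
have lnM_le : ln M <= M - 1.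
  by have := expR_ge1Dx (ln M); rewrite lnK ?posrE//; lra.
suff : ln M <= 2^-1 * eta * (A - B) + (4 + 16 * expR 2 ^+ 2) * eta ^+ 3.
  by rewrite lnM; lra.
(* [ln M * M] is at most [(M - 1) * M], which is [M - 1] plus its square. [M3] bounds the first part
   and [M4] the second, and [1 <= M] absorbs the factor [M] in the error term. *)
rewrite -(ler_pM2r M0).
have e2 := expR_gt0 (2 : R).
have M4 : (M - 1) ^+ 2 <= 16 * expR 2 ^+ 2 * eta ^+ 3.
  apply: (@le_trans _ _ ((4 * expR 2 * eta ^+ 2) ^+ 2)).
    by rewrite lerXn2r ?nnegrE ?subr_ge0// !mulr_ge0 ?exprn_ge0// ltW.
  rewrite (_ : _ ^+ 2 = 16 * expR 2 ^+ 2 * eta ^+ 3 * eta); last ring.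
  by rewrite ler_piMr// !mulr_ge0 ?exprn_ge0// ltW.
have K0 : 0 <= (4 + 16 * expR 2 ^+ 2) * eta ^+ 3.
  by rewrite mulr_ge0 ?exprn_ge0 ?(ltW eta0).
apply: (@le_trans _ _ ((M - 1) * M)); first by rewrite ler_wpM2r// ltW.
rewrite mulrDl; have : (4 + 16 * expR 2 ^+ 2) * eta ^+ 3 <=
    (4 + 16 * expR 2 ^+ 2) * eta ^+ 3 * M by rewrite ler_peMr.
lra.
Qed.

End hedge_step.

(** * Barycenters *)

Section lower_bounds.
Context d (T : measurableType d) (R : realType).
Variables (mu : {measure set T -> \bar R}) (D : set T).
Hypotheses (mD : measurable D) (Doo : (mu D < +oo)%E).

Lemma expR_bounded_mfun_gt0 (g : T -> R) : bounded_mfun D g ->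
  exists2 m, 0 < m & forall x, D x -> m <= expR (g x).
Proof.
move=> [_ [M gM]]; exists (expR (- M)); first exact: expR_gt0.
by move=> x /gM; rewrite ler_expR ler_norml => /andP[].
Qed.

Lemma Rintegral_ge_on_subset (B : set T) (w : T -> R) m : bounded_mfun D w ->
  measurable B -> B `<=` D -> (forall x, D x -> 0 <= w x) ->
  (forall x, B x -> m <= w x) ->
  m * fine (mu B) <= Rintegral mu D w.
Proof.
move=> bw mB BD w0 mw.
have intw := bounded_mfun_integrable mD Doo bw.
have Boo : (mu B < +oo)%E.
  by apply: le_lt_trans Doo; apply: le_measure; rewrite ?inE.
rewrite -Rintegral_cst// (@le_trans _ _ (Rintegral mu B w))//.
  apply: le_Rintegral => //; last by apply: integrableS intw.
  by apply: bounded_mfun_integrable => //; exact: bounded_mfun_cst.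
rewrite /Rintegral fine_le//.
- apply: integrable_fin_num => //; exact: integrableS intw.
- exact: integrable_fin_num.
- apply: ge0_subset_integral => //; first by case/integrableP : intw.
Qed.

End lower_bounds.

Section barycenter.
Context {R : realType} {d : nat}.
Variables (U : set 'rV[R]_d) (w : 'rV[R]_d -> R).
Hypotheses (mU : measurable U) (bU : bounded_set U).
Hypotheses (bw : bounded_mfun U w).

Local Notation mu := (@lebesgue_rV R d).
Local Notation Z := (Rintegral mu U w).
Hypothesis Z_gt0 : 0 < Z.

Let b : 'rV[R]_d := \row_i (\int[mu]_(x in U) (w x * x 0 i) / Z).

Let Uoo : (mu U < +oo)%E. Proof. exact: lebesgue_rV_bounded_lty. Qed.

Lemma bounded_mfun_coord i : bounded_mfun U (fun x : 'rV[R]_d => x 0 i).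
Proof.
split.
  by apply: (measurable_funS measurableT) => //; exact: measurable_coord.
have [M [_ UM]] := bU; exists (`|M| + 1) => x Ux.
have M1 : `|x| <= `|M| + 1 by apply: UM; rewrite // ltr_pwDr// ler_norm.
rewrite leNgt; apply/negP => M2.
have : `|x| < `|x 0 i| by exact: le_lt_trans M2.
have xi0 : 0 < `|x 0 i| by apply: le_lt_trans M2; rewrite addr_ge0.
by move=> /(rV_norm_lt _ xi0)/(_ i); rewrite ltxx.
Qed.

(** The mean of an affine function is its value at the barycenter [b], here [c]. This serves both
    Jensen's inequality and the proof that [b] lies in [U]. *)
Lemma barycenter_affine_le (g : 'cV[R]_d) c (q : 'rV[R]_d -> R) :
  bounded_mfun U q ->
  (forall x, U x -> 0 <= w x) ->
  (forall y, U y -> c + ((y - b) *m g) 0 0 <= q y) ->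
  c <= \int[mu]_(x in U) (q x * w x) / Z.
Proof.
move=> bq w0 cq; rewrite ler_pdivlMr//.
have bZ k h : bounded_mfun U h -> bounded_mfun U (fun x => k * h x).
  by move=> bh; apply: bounded_mfunM => //; exact: bounded_mfun_cst.
have bwx i : bounded_mfun U (fun x => w x * x 0 i).
  by apply: bounded_mfunM => //; exact: bounded_mfun_coord.
have -> : c * Z = \int[mu]_(x in U)
    ((c - (b *m g) 0 0) * w x + \sum_i g i 0 * (w x * x 0 i)).
  rewrite Rintegral_bmfunD//; last 2 first.
  - exact: bZ.
  - by apply: bounded_mfun_sum => i _; exact: bZ.
  rewrite Rintegral_bmfunZ// Rintegral_bmfun_sum// mulrBl -addrA.
  rewrite [X in c * Z + X](_ : _ = 0) ?addr0//.
  apply/eqP; rewrite addrC subr_eq0; apply/eqP.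
  rewrite mxE mulr_suml; apply: eq_bigr => i _.
  by rewrite mxE mulrAC divfK ?gt_eqF// mulrC.
apply: le_Rintegral_bmfun => //.
- apply: bounded_mfunD; first exact: bZ.
  by apply: bounded_mfun_sum => i _; exact: bZ.
- exact: bounded_mfunM.
move=> y Uy; apply: le_trans (ler_wpM2r (w0 _ Uy) (cq _ Uy)).
rewrite mulmxBl [X in _ <= (_ + X) * _]mxE [X in _ <= (_ + (_ + X)) * _]mxE.
rewrite [X in _ <= (_ + (X - _)) * _]mxE le_eqVlt; apply/orP; left; apply/eqP.
rewrite [LHS]addrC [X in _ = X * _]addrCA [RHS]mulrDl [X in _ = X + _]mulr_suml.
congr (_ + _).
by apply: eq_bigr => i _; ring.
Qed.

(** Otherwise a separating functional centred at [b] is nonpositive on [U] and at most -1/2 on a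
    half-size copy [B] of positive weight; its mean would be negative, yet it is 0. *)
Lemma barycenter_mem m : @convex_set R 'rV[R]_d U -> open U -> U !=set0 ->
  0 < m -> (forall x, U x -> m <= w x) -> U b.
Proof.
move=> cU oU [x0 Ux0] m0 mw; apply: contrapT => Ub.
have w0 x : U x -> 0 <= w x by move=> /mw; apply: le_trans; exact: ltW.
have [g gP] := convex_separation cU Ux0 (fun v => open_line v oU Ux0) Ub.
pose B := (fun y : 'rV[R]_d => - x0 + 2 *: y) @^-1` U.
have mB : measurable B.
  by rewrite -[X in measurable X]setTI; exact: measurable_affine.
have Bu y : x0 + 2^-1 *: (- x0 + 2 *: y - x0) = y.
  by apply/rowP => i; rewrite !mxE; field.
have BU : B `<=` U.
  move=> y By; rewrite -(Bu y).
  rewrite (_ : _ + _ = 2^-1 *: (- x0 + 2 *: y) + (1 - 2^-1) *: x0).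
    by move/convex_setP : cU; apply => //; apply/andP; split; lra.
  by apply/rowP => i; rewrite !mxE; field.
have B0 : 0 < fine (mu B).
  apply: fine_gt0; apply/andP; split.
    have := lebesgue_rV_affine (- x0) (ltr0n _ 2) mU.
    have := lebesgue_rV_open_gt0 oU (ex_intro _ x0 Ux0).
    move=> /[swap] <-; rewrite pmule_rgt0//.
  by apply: le_lt_trans Uoo; apply: le_measure; rewrite ?inE.
have bB : bounded_mfun U (\1_B : _ -> R).
  split; first exact: measurable_indic.
  by exists 1 => x _; rewrite indicE ger0_norm// lern1; case: (_ \in _).
have bBw : bounded_mfun U (fun x => \1_B x * w x) by exact: bounded_mfunM.
have bq : bounded_mfun U (fun x => - 2^-1 * (\1_B x : R)).
  by apply: bounded_mfunM => //; exact: bounded_mfun_cst.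
have := @barycenter_affine_le g 0 _ bq w0; rewrite leNgt => /(_ _)/negP; apply.
  move=> y Uy; rewrite add0r indicE; have [yB|yB] := boolP (y \in B).
    by rewrite mulr1 -{1}(Bu y); apply: (gP _ _).2; exact: set_mem.
  by rewrite mulr0; exact: (gP _ Uy).1.
under eq_Rintegral do rewrite -mulrA.
rewrite Rintegral_bmfunZ// -mulrA mulNr oppr_lt0 mulr_gt0// divr_gt0//.
apply: (@lt_le_trans _ _ (m * fine (mu B))); first by rewrite mulr_gt0.
apply: Rintegral_ge_on_subset => //.
- by move=> x Ux; rewrite mulr_ge0// w0.
- by move=> x Bx; rewrite indicE mem_set// mul1r mw//; exact: BU.
Qed.

End barycenter.

(** A point [y] within [s * r] of [x] divides the segment from [x] to a point of the ball, and [x]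
    divides the segment from [y] to the opposite point. Convexity on both bounds the change of [h]
    by [2 * s]. *)
Lemma convex_bounded_continuous {R : realType} {V : normedModType R}
    (A : set V) (h : V -> R) x :
  @convex_function R V A h -> (forall y, A y -> `|h y| <= 1) -> A° x ->
  {for x, continuous h}.
Proof.
move=> /convex_functionP ch h1 /nbhs_ballP[r /= r0 rA].
have Ax : A x by apply: rA; exact: ballxx.
apply/cvgrPdist_le => /= e e0.
pose s := Num.min 1 (e / 2).
have s0 : 0 < s by rewrite lt_min ltr01 divr_gt0.
have [s1 se] : s <= 1 /\ s <= e / 2 by split; rewrite ge_min lexx ?orbT.
apply/nbhs_ballP; exists (s * r); rewrite /= ?mulr_gt0// => y.
rewrite -ball_normE/= => xy.
have norm_sV : `|s^-1 *: (y - x)| < r.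
  rewrite normrZ gtr0_norm ?invr_gt0// mulrC ltr_pdivrMr// distrC mulrC//.
have Ay : A y.
  apply: rA; rewrite -ball_normE/=; apply: lt_le_trans xy _.
  by rewrite ler_piMl// ltW.
have Az : A (x + s^-1 *: (y - x)).
  by apply: rA; rewrite -ball_normE/= opprD addNKr normrN.
have Az' : A (x - s^-1 *: (y - x)).
  by apply: rA; rewrite -ball_normE/= opprB addrC subrK.
have := h1 _ Ax; have := h1 _ Az; have := h1 _ Az'; rewrite !ler_norml.
move=> /andP[? ?] /andP[? ?] /andP[? ?]; apply/andP; split.
  have s01 : 0 <= s <= 1 by rewrite (ltW s0).
  have := ch _ _ _ s01 Az Ax.
  rewrite (_ : _ *: _ + _ = y); first by nra.
  rewrite scalerDr scalerA divff ?gt_eqF// scale1r scalerBl scale1r addrAC.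
  by rewrite [_ + (x - _)]addrC subrK addrC subrK.
have ss0 : 0 < 1 + s by rewrite addr_gt0.
have s01 : 0 <= (1 + s)^-1 <= 1.
  by apply/andP; split; [rewrite invr_ge0 ltW|rewrite invf_le1// lerDl ltW].
have := ch _ _ _ s01 Ay Az'; rewrite (_ : _ *: _ + _ = x); last first.
  have -> : 1 - (1 + s)^-1 = (1 + s)^-1 * s by field; rewrite gt_eqF.
  rewrite -scalerA -scalerDr scalerBr scalerA divff ?gt_eqF// scale1r opprB.
  rewrite [y + _]addrC -addrA subrK -{2}(scale1r x) -scalerDl (addrC s).
  by rewrite scalerA mulVf ?gt_eqF// scale1r.
rewrite -(ler_pM2l ss0) mulrDr !mulrA divff ?gt_eqF// mul1r.
rewrite mulrBr mulr1 divff ?gt_eqF// addrAC subrr add0r; nra.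
Qed.

(** * The regret of continuous Hedge *)

Section hedge_regret.
Context {R : realType} {d T : nat}.
Variables (X : set 'rV[R]_d) (f : nat -> 'rV[R]_d -> R) (eta : R).
Hypotheses (cX : @convex_set R 'rV[R]_d X) (bX : bounded_set X).
Hypothesis X0 : X° !=set0.
Hypothesis cf :
  forall t, (1 <= t <= T)%N -> @convex_function R 'rV[R]_d X (f t).
Hypothesis f1 : forall t, (1 <= t <= T)%N -> forall x, X x -> `|f t x| <= 1.

Local Notation mu := (@lebesgue_rV R d).
Local Notation w := (hedge_weight f eta).
Local Notation p := (hedge_point X f eta).
(** Taken over the interior, which is Borel and on which the losses are continuous. *)
Let Z t := \int[mu]_(x in X°) w t x.

Let oU : open X°. Proof. exact: open_interior. Qed.
Let mU : measurable X°. Proof. exact: open_measurable_rV. Qed.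
Let cU : @convex_set R 'rV[R]_d X°. Proof. exact: convex_interior. Qed.
Let bU : bounded_set X°.
Proof.
have [M [Mr MX]] := bX; exists M; split => // r Mlt y /interior_subset.
exact: MX.
Qed.
Let Uoo : (mu X° < +oo)%E. Proof. exact: lebesgue_rV_bounded_lty. Qed.

Let bf t : (1 <= t <= T)%N -> bounded_mfun X° (f t).
Proof.
move=> tT; split; last by exists 1 => x /interior_subset; exact: f1.
apply: open_continuous_measurable_fun_rV => // x; rewrite inE => Ux.
exact: convex_bounded_continuous (cf tT) (f1 tT) Ux.
Qed.

Let b_exponent t : (t <= T.+1)%N ->
  bounded_mfun X° (fun x => - eta * \sum_(1 <= s < t) f s x).
Proof.
move=> tT; apply: bounded_mfunM; first exact: bounded_mfun_cst.
apply: bounded_mfun_sum => s; rewrite mem_index_iota => /andP[s1 st].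
by apply: bf; rewrite s1 -ltnS (leq_trans st).
Qed.

Let bw t : (t <= T.+1)%N -> bounded_mfun X° (w t).
Proof. by move=> tT; apply: bounded_mfun_expR; exact: b_exponent. Qed.

Let w_ge0 t x : 0 <= w t x. Proof. exact: expR_ge0. Qed.

Let leb_gt0 : 0 < fine (mu X°).
Proof. by apply: fine_gt0; rewrite Uoo lebesgue_rV_open_gt0. Qed.

Let Z_gt0 t : (t <= T.+1)%N -> 0 < Z t.
Proof.
move=> tT; have [m m0 mw] := expR_bounded_mfun_gt0 (b_exponent tT).
apply: (@lt_le_trans _ _ (m * fine (mu X°))); first by rewrite mulr_gt0.
by apply: Rintegral_ge_on_subset => //; exact: bw.
Qed.

Let hedge_pointE t : (t <= T.+1)%N ->
  p t = \row_i (\int[mu]_(x in X°) (w t x * x 0 i) / Z t).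
Proof.
move=> tT; have [N [mN N0 XN]] := convex_diff_interior_null cX bX X0.
have XU g : \int[mu]_(x in X) g x = \int[mu]_(x in X°) g x.
  apply/esym; apply: (eq_Rintegral_null g mN N0) => //.
  exact: interior_subset.
apply/rowP => i; rewrite !mxE XU /hedge_density XU -/(Z t).
rewrite mulrC -(Rintegral_bmfunZ mU Uoo).
  by apply: eq_Rintegral => x _; ring.
apply: bounded_mfunM; first exact: bw.
exact: bounded_mfun_coord.
Qed.

(** Membership in the interior, and not just in [X], provides the subgradients at the played points
    that Jensen's inequality uses. *)
Lemma hedge_point_interior t : (t <= T.+1)%N -> X° (p t).
Proof.
move=> tT; rewrite hedge_pointE//.
have [m m0 mw] := expR_bounded_mfun_gt0 (b_exponent tT).
by apply: barycenter_mem mw => //; [exact: bw|exact: Z_gt0].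
Qed.

Let hedge_jensen s t : (1 <= s <= T)%N -> (t <= T.+1)%N ->
  f s (p t) <= \int[mu]_(x in X°) (f s x * w t x) / Z t.
Proof.
move=> sT tT; have Up := hedge_point_interior tT.
have cfU : @convex_function R 'rV[R]_d X° (f s).
  move=> l x y; rewrite !inE => Ux Uy.
  by apply: (cf sT); rewrite inE; exact: interior_subset.
have [g gP] := subgradient_exists cU cfU Up (fun v => open_line v oU Up).
apply: (@barycenter_affine_le _ _ _ _ mU bU (bw tT) (Z_gt0 tT) g) => //.
  exact: bf.
by move=> y Uy; rewrite -hedge_pointE//; exact: gP.
Qed.

Let hedge_weightS t x : (0 < t)%N -> w t.+1 x = expR (- eta * f t x) * w t x.
Proof.
by move=> t0; rewrite /hedge_weight big_nat_recr//= mulrDr expRD mulrC.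
Qed.

Hypothesis eta01 : 0 < eta <= 1.

Let hedge_step t : (1 <= t <= T)%N ->
  2^-1 * eta * (f t (p t) + f t (p t.+1)) <=
    ln (Z t) - ln (Z t.+1) + (4 + 16 * expR 2 ^+ 2) * eta ^+ 3.
Proof.
move=> tT; have /andP[t1 tT'] := tT; have /andP[eta0 _] := eta01.
have wE : w t.+1 = fun x => expR (- eta * f t x) * w t x.
  by apply/funext => x; rewrite hedge_weightS.
have := @hedge_trapezoid _ _ R mu X° mU Uoo (w t) (f t) eta
  (bw (leqW tT')) (bf tT).
rewrite -/(Z t) -wE -/(Z t.+1) => /(_ _ _ eta01 (Z_gt0 (leqW tT')) (Z_gt0 _)).
move=> step; apply: le_trans (step _ _ _).
- rewrite ler_pM2l ?mulr_gt0 ?invr_gt0// lerD//; first exact/hedge_jensen/leqW.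
  have := hedge_jensen tT (tT' : (t.+1 <= T.+1)%N).
  by under eq_Rintegral do rewrite hedge_weightS//.
- by move=> x _; exact: w_ge0.
- by move=> x /interior_subset; exact: f1.
- by [].
Qed.

Let ln_Z_ratio u : X u -> (0 < T)%N ->
  ln (Z 1) - ln (Z T.+1) <=
    eta * (\sum_(1 <= t < T.+1) f t u + 2) + d%:R * ln T%:R.
Proof.
move=> Xu T0; have T0' : 0 < T%:R :> R by rewrite ltr0n.
have /andP[eta0 _] := eta01.
(* The interior shrunk by the factor [T%:R^-1] towards [u]. *)
pose B := (fun y : 'rV[R]_d => (1 - T%:R) *: u + T%:R *: y) @^-1` X°.
have mB : measurable B.
  by rewrite -[X in measurable X]setTI; exact: measurable_affine.
have T01 : 0 < (T%:R : R)^-1 <= 1.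
  by rewrite invr_gt0 T0' invf_le1// ler1n.
have T01' : 0 <= (T%:R : R)^-1 <= 1.
  by have /andP[/ltW -> ->] := T01.
have BE y : y = T%:R^-1 *: ((1 - T%:R) *: u + T%:R *: y) + (1 - T%:R^-1) *: u.
  by apply/rowP => i; rewrite !mxE; field; rewrite gt_eqF.
have BU : B `<=` X°.
  by move=> y By; rewrite (BE y); exact: convex_interior_segment.
(* Convexity gives [f t y <= f t u + 2 / T%:R], and the [T] excesses add up to 2. *)
have BX y : B y -> - eta * (\sum_(1 <= t < T.+1) f t u + 2) <=
    - eta * \sum_(1 <= t < T.+1) f t y.
  move=> By; rewrite ler_nM2l ?oppr_lt0//.
  have -> : 2 = \sum_(1 <= t < T.+1) (2 / T%:R) :> R.
    by rewrite sumr_const_nat subn1 -[LHS](divfK (lt0r_neq0 T0')) mulr_natr.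
  rewrite -big_split/=; apply: ler_sum_nat => t tT.
  have By' := interior_subset By.
  have /convex_functionP/(_ _ _ _ T01' By' Xu) := cf tT; rewrite -BE.
  have := f1 tT By'; have := f1 tT Xu; rewrite !ler_norml.
  have /andP[/ltW e0 _] := T01.
  move=> /andP[/(ler_wpM2l e0) fu _] /andP[_ /(ler_wpM2l e0) fy] ch.
  lra.
have volB : T%:R ^+ d * fine (mu B) = fine (mu X°).
  have Boo : (mu B < +oo)%E.
    by apply: le_lt_trans Uoo; apply: le_measure; rewrite ?inE.
  rewrite -(lebesgue_rV_affine ((1 - T%:R) *: u) T0' mU) fineM// ge0_fin_numE//.
have Z1 : Z 1 = fine (mu X°).
  rewrite /Z -[RHS]mul1r -Rintegral_cst//; apply: eq_Rintegral => x _.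
  by rewrite /hedge_weight big_geq// mulr0 expR0.
have volB0 : 0 < fine (mu B).
  by rewrite -(pmulr_rgt0 _ (exprn_gt0 d T0')) volB.
have ZT :
    expR (- eta * (\sum_(1 <= t < T.+1) f t u + 2)) * fine (mu B) <= Z T.+1.
  apply: Rintegral_ge_on_subset => //; first exact: bw.
  by move=> y By; rewrite ler_expR; exact: BX.
move: ZT; rewrite -ler_ln ?posrE ?mulr_gt0 ?expR_gt0 ?Z_gt0//.
rewrite lnM ?posrE ?expR_gt0// expRK Z1 -volB lnM ?posrE ?exprn_gt0// lnXn//.
rewrite -mulr_natl; lra.
Qed.

Lemma hedge_regret u : X u -> (0 < T)%N ->
  \sum_(1 <= t < T.+1) (f t (p t) + f t (p t.+1)) -
    2 * \sum_(1 <= t < T.+1) f t u <=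
  2 * (d%:R * ln T%:R) / eta + 4 + (8 + 32 * expR 2 ^+ 2) * (T%:R * eta ^+ 2).
Proof.
move=> Xu T0; have /andP[eta0 _] := eta01.
have steps : 2^-1 * eta * \sum_(1 <= t < T.+1) (f t (p t) + f t (p t.+1)) <=
    ln (Z 1) - ln (Z T.+1) + T%:R * ((4 + 16 * expR 2 ^+ 2) * eta ^+ 3).
  have -> : ln (Z 1) - ln (Z T.+1) =
      \sum_(1 <= t < T.+1) (ln (Z t) - ln (Z t.+1)).
    have := telescope_sumr (fun t => - ln (Z t)) (leqW T0).
    by under eq_bigr do rewrite opprK addrC; move=> ->; rewrite opprK addrC.
  have -> : T%:R * ((4 + 16 * expR 2 ^+ 2) * eta ^+ 3) =
      \sum_(1 <= t < T.+1) ((4 + 16 * expR 2 ^+ 2) * eta ^+ 3).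
    by rewrite sumr_const_nat subn1 mulr_natl.
  rewrite mulr_sumr -big_split/=; apply: ler_sum_nat => t tT.
  exact: hedge_step.
have := ln_Z_ratio Xu T0; move: steps.
set S := \sum_(_ <= _ < _) (_ + _); set F := \sum_(_ <= _ < _) _ => steps ratio.
(* After multiplication by [eta / 2], the term 4 becomes the [2 * eta] left by the shrinking
   argument. *)
rewrite -(ler_pM2l (_ : 0 < 2^-1 * eta)) ?mulr_gt0 ?invr_gt0//.
have -> : 2^-1 * eta * (2 * (d%:R * ln T%:R) / eta + 4 +
    (8 + 32 * expR 2 ^+ 2) * (T%:R * eta ^+ 2)) = d%:R * ln T%:R + 2 * eta +
    T%:R * ((4 + 16 * expR 2 ^+ 2) * eta ^+ 3).
  by field; rewrite gt_eqF.
move: steps ratio; move: (ln _) (ln _) S F => z z' S F steps ratio; lra.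
Qed.

End hedge_regret.

(** A bounded convex domain with nonempty interior has finite positive volume, which makes the
    densities well defined. For [T = 1] the right-hand side would vanish, as [ln 1 = 0]. *)
Theorem theorem4 (R : realType) :
  exists C : R, 0 < C /\
    forall (d T : nat) (X : set 'rV[R]_d) (f : nat -> 'rV[R]_d -> R),
      (0 < d)%N -> (1 < T)%N ->
      @convex_set R 'rV[R]_d X ->
      bounded_set X ->
      X° !=set0 ->
      (forall t : nat, (1 <= t <= T)%N ->
         @convex_function R 'rV[R]_d X (f t)) ->
      (forall t : nat, (1 <= t <= T)%N -> forall x, X x -> `|f t x| <= 1) ->
      alternating_regret X f T (hedge_point X f (hedge_eta d T)) <=
        C * (d%:R `^ (2 / 3) * T%:R `^ (3^-1) * (ln T%:R) `^ (2 / 3)).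
Proof.
pose K : R := 8 + 32 * expR 2 ^+ 2.
have K0 : 0 <= K by rewrite addr_ge0// mulr_ge0// exprn_ge0 ?expR_ge0.
exists (10 + K); split; first by rewrite ltr_pwDl.
move=> d T X f d0 T1 cX bX X0 cf f1.
have T0 : (0 < T)%N by exact: ltnW.
have T0' : 0 < T%:R :> R by rewrite ltr0n.
have d1 : 1 <= d%:R :> R by rewrite ler1n.
have lnT : 2^-1 <= ln T%:R :> R.
  rewrite -[2^-1]expRK ler_ln ?posrE ?expR_gt0//.
  apply: (@le_trans _ _ 2); last by rewrite ler_nat.
  have := expR_ge1Dx (- 2^-1 : R); rewrite expRN => e.
  rewrite -[leLHS]invrK invf_ple ?posrE ?invr_gt0 ?expR_gt0//; lra.
have lnT0 : 0 < ln T%:R :> R by apply: lt_le_trans lnT; rewrite invr_gt0.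
(* With these cube roots the rate is [a * b ^+ 2] and the step size is the minimum of 1 and
   [b / a]. *)
pose a : R := T%:R `^ 3^-1; pose b : R := (d%:R * ln T%:R) `^ 3^-1.
have dlnT0 : 0 < d%:R * ln T%:R :> R by rewrite mulr_gt0// (lt_le_trans _ d1).
have a0 : 0 < a by rewrite powR_gt0.
have b0 : 0 < b by rewrite powR_gt0.
have a3 : a ^+ 3 = T%:R.
  by rewrite -powR_mulrn ?powR_ge0// -powRrM mulVf ?pnatr_eq0// powRr1 ?ltW.
have b3 : b ^+ 3 = d%:R * ln T%:R.
  by rewrite -powR_mulrn ?powR_ge0// -powRrM mulVf ?pnatr_eq0// powRr1 ?ltW.
have QE : d%:R `^ (2 / 3) * T%:R `^ 3^-1 * (ln T%:R) `^ (2 / 3) = a * b ^+ 2.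
  rewrite mulrAC mulrC -powRM ?ltW// ?(lt_le_trans _ d1)//; congr (_ * _).
  by rewrite (mulrC 2) powRrM powR_mulrn ?powR_ge0.
have etaE : hedge_eta d T = Num.min 1 (b / a) :> R.
  by rewrite /hedge_eta powRN mulrC.
rewrite QE etaE; set eta := Num.min _ _.
have a1 : 1 <= a.
  by rewrite -(powRr0 T%:R); apply: ler_powR; rewrite ?ler1n ?invr_ge0.
have b2 : 2^-1 <= b ^+ 2.
  have b3_ge : 2^-1 <= b ^+ 3.
    by rewrite b3; apply: le_trans lnT _; rewrite ler_peMl// ltW.
  have [b1|/ltW b1] := leP b 1.
    by apply: (le_trans b3_ge); rewrite exprS ler_piMl ?exprn_ge0 ?(ltW b0).
  have : 1 <= b ^+ 2 by rewrite exprn_ege1.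
  lra.
(* This turns the additive 4 of [hedge_regret] into [8 * (a * b ^+ 2)], whence the constant
   [10 + K]. *)
have Q1 : 2^-1 <= a * b ^+ 2.
  by apply: (le_trans b2); rewrite ler_peMl ?exprn_ge0 ?(ltW b0).
have eta01 : 0 < eta <= 1.
  by rewrite /eta lt_min ltr01 divr_gt0//= ge_min lexx.
apply: ge_sup.
  by have [x Xx] := X0; eexists; exists x => //; exact: interior_subset.
move=> _ [u Xu <-].
have [ba|ab] := leP b a.
  (* This step size balances the two main terms: both become multiples of [a * b ^+ 2]. *)
  have etaba : eta = b / a by rewrite /eta min_r// ler_pdivrMr// mul1r.
  have := hedge_regret cX bX X0 cf f1 eta01 Xu T0.
  move=> /le_trans; apply; rewrite -b3 -a3 etaba -/K.
  have -> : 2 * b ^+ 3 / (b / a) + 4 + K * (a ^+ 3 * (b / a) ^+ 2) =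
      (2 + K) * (a * b ^+ 2) + 4 by field; rewrite !gt_eqF.
  lra.
(* Here [T%:R < d%:R * ln T%:R]: each round costs at most 4, and [a ^+ 3 <= a * b ^+ 2]. *)
apply: (@le_trans _ _ (4 * T%:R)).
  have -> : 4 * T%:R = \sum_(1 <= t < T.+1) 4 :> R.
    by rewrite sumr_const_nat subn1 mulr_natr.
  rewrite mulr_sumr -sumrB; apply: ler_sum_nat => t tT.
  have Xp s : (s <= T.+1)%N -> X (hedge_point X f eta s).
    by move=> sT; apply: interior_subset; exact: (@hedge_point_interior _ _ T).
  have /andP[_ tT'] := tT.
  have alt_le (x y z : R) :
      `|x| <= 1 -> `|y| <= 1 -> `|z| <= 1 -> x + y - 2 * z <= 4.
    by rewrite !ler_norml => /andP[_ ?] /andP[_ ?] /andP[? _]; lra.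
  by apply: alt_le; apply: f1 => //; apply: Xp => //; exact: ltnW.
rewrite -a3.
have : a ^+ 3 <= a * b ^+ 2.
  by rewrite exprS ler_pM2l// lerXn2r ?nnegrE ?ltW.
nra.
Qed.
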